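(* Consider the linearly constrained problem of minimizing $f(x)$ over $x\in\mathbb{R}^n$ subject to $A'x+b'\le0$, $Ax+b=0$, $x\in X$, under the assumptions (a)–(c) listed in the context. Let $(u_k)_{k=0}^\infty\subset D$ be a sequence generated by the fast dual gradient method described in the context, and let $u^\star\in D^\star$. Then, for any $k\ge1$, $$d^\star-d(u_k)\le\frac{2\sigma_{\max}^2(\tilde{A})\|u_0-u^\star\|^2}{\theta(k+1)^2},$$ $$\|\bar{x}(u_k)-x^\star\|\le\frac{2\sigma_{\max}(\tilde{A})\|u_0-u^\star\|}{\theta(k+1)},$$ $$-\frac{2\|u^\star\|\sigma_{\max}^2(\tilde{A})\|u_0-u^\star\|}{\theta(k+1)}\le f(\bar{x}(u_k))-f^\star\le\frac{2\|u_k\|\sigma_{\max}^2(\tilde{A})\|u_0-u^\star\|}{\theta(k+1)},$$ $$\Delta(\bar{x}(u_k))\le\frac{2\sigma_{\max}^2(\tilde{A})\|u_0-u^\star\|}{\theta(k+1)}.$$ Moreover, if $p=0$ (no equality constraints), then for $\tilde{x}$ as in assumption (b) and $\bar{u}\in D\setminus D^\star$, $$f(\bar{x}(u_k))-f^\star\le\frac{2\sigma_{\max}^2(\tilde{A})(d(\bar{u})-f(\tilde{x}))\|u_0-u^\star\|}{\theta(k+1)\max_{i\in\{1,\dots,m\}}g^{(i)}(\tilde{x})},\qquad\forall k>\sigma_{\max}(\tilde{A})\|u_0-u^\star\|\left(\frac{2\theta^{-1}}{d^\star-d(\bar{u})}\right)^{1/2},$$ where $g^{(i)}(x)=(A'x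+b')^{(i)}$.
   Context: Problem data: $f:\mathbb{R}^n\to\mathbb{R}$, $A'\in\mathbb{R}^{m\times n}$, $b'\in\mathbb{R}^m$, $A\in\mathbb{R}^{p\times n}$, $b\in\mathbb{R}^p$, $X\subseteq\mathbb{R}^n$ closed and convex; $\le$ between vectors is element-wise. Put $\tilde{A}=[(A')^T,A^T]^T\in\mathbb{R}^{(m+p)\times n}$ and $\tilde{b}=[(b')^T,b^T]^T\in\mathbb{R}^{m+p}$; $\tilde{A}$ is assumed nonzero. Assumptions: (a) $f$ is strongly convex over $X$ with parameter $\theta>0$: $f(y)-f(x)-s^T(y-x)\ge\frac{\theta}{2}\|x-y\|^2$ for all $x,y\in X$ and all $s\in\partial f(x)$ ($\partial f$ the subdifferential; $f$ need not be differentiable). (b) There exists $\tilde{x}\in\operatorname{relint}X$ with $A'\tilde{x}+b'<0$ element-wise and $A\tilde{x}+b=0$. (c) $m+p\neq0$, and if $p\ne0$ then $A$ is not the zero matrix. The problem has a unique optimal solution $x^\star$, with finite optimal value $f^\star=f(x^\star)$. $\|\cdot\|$ is the Euclidean norm, $v^{(i)}$ the $i$th entry of $v$, and $\sigma_{\max}(\tilde{A})=\sqrt{\lambda_{\max}(\tilde{A}^T\tilde{A})}$ with $\lambda_{\max}$ the largest eigenvalue. Dual: $\mathcal{L}(x,u)=f(x)+u^T(\tilde{A}x+\tilde{b})$ for $u\in\mathbb{R}^{m+p}$. For every $u\in\mathbb{R}^{m+p}$, $\bar{x}(u)$ is the unique minimizer of $\mathcal{L}(\cdot,u)$ over $X$,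 $d(u)=\min_{x\in X}\mathcal{L}(x,u)$, and $\nabla d(u)=\tilde{A}\bar{x}(u)+\tilde{b}$. $D=\{u\in\mathbb{R}^{m+p}:u^{(i)}\ge0,\ i=1,\dots,m\}$. The dual problem is to maximize $d$ over $D$; its optimal value is $d^\star$ (and $d^\star=f^\star$), and its set of optimal solutions $D^\star$ is nonempty. The primal infeasibility is $\Delta(\bar{x}(u))=\bigl(\|A\bar{x}(u)+b\|^2+\sum_{i=1}^m(\max\{0,(A'\bar{x}(u)+b')^{(i)}\})^2\bigr)^{1/2}$. Algorithm (fast dual gradient method): let $\ell_{-d}(u,v)=-d(v)-\nabla d(v)^T(u-v)$ for $u,v\in\mathbb{R}^{m+p}$. Initialization: let $\beta_0=\beta_{-1}=1$ and choose $u_0=u_{-1}\in D$. At each $k\ge0$: choose a closed convex set $U_k\subseteq\mathbb{R}^{m+p}$ such that $U_k\cap D^\star\ne\emptyset$; set $$v_k=u_k+\beta_k(1/\beta_{k-1}-1)(u_k-u_{k-1}),\qquad u_{k+1}=\operatorname{arg\,min}_{u\in U_k\cap D}\ \ell_{-d}(u,v_k)+\frac{\sigma_{\max}^2(\tilde{A})}{2\theta}\|u-v_k\|^2;$$ choose $\beta_{k+1}\le2/(k+3)$.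
   Formalization: As stated the rates can fail; the formal theorem also assumes β_k>0 with (1−β_{k+1})/β_{k+1}² ≤ 1/β_k², and that each U_k contains (1−β_k)u_k+β_k u* (true if U_k contains u_k and u* ), and ∂f(x) nonempty on X. *)

(* Defs.v *)
(* MathComp-Analysis: vectors of R^n are column matrices 'cV[R]_n over an
   arbitrary R : realType. *)
From HB Require Import structures.
From mathcomp Require Import all_boot all_order all_algebra.
From mathcomp Require Import all_classical all_reals all_analysis.
Import Order.TTheory GRing.Theory Num.Theory.
Import numFieldNormedType.Exports.

Set Implicit Arguments.
Unset Strict Implicit.
Unset Printing Implicit Defensive.

Local Open Scope classical_set_scope.
Local Open Scope ring_scope.

Section Euclidean.
Context {R : realType}.

Definition dotv {q} (u v : 'cV[R]_q) : R := \sum_(i < q) u i 0 * v i 0.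

(* The library norm of a matrix is the max norm. *)
Definition enorm {q} (v : 'cV[R]_q) : R := Num.sqrt (\sum_(i < q) v i 0 ^+ 2).

Definition is_argmin {T : Type} (F : T -> R) (S : set T) (x : T) : Prop :=
  S x /\ forall y, S y -> F x <= F y.

Definition is_argmax {T : Type} (F : T -> R) (S : set T) (x : T) : Prop :=
  S x /\ forall y, S y -> F y <= F x.

Definition aff_hull {n} (X : set 'cV[R]_n) : set 'cV[R]_n :=
  [set y | exists (N : nat) (c : 'I_N -> R) (x : 'I_N -> 'cV[R]_n),
     [/\ forall i, X (x i), \sum_(i < N) c i = 1 &
         y = \sum_(i < N) c i *: x i]].

Definition relint {n} (X : set 'cV[R]_n) : set 'cV[R]_n :=
  [set x | aff_hull X x /\
     exists2 e : R, 0 < e &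
       forall y, aff_hull X y -> enorm (y - x) < e -> X y].

Definition subdifferential {n} (f : 'cV[R]_n -> R) (x : 'cV[R]_n) :
    set 'cV[R]_n :=
  [set s | forall y, f x + dotv s (y - x) <= f y].

(* The subdifferential is required to be nonempty on X, as it is for every
   finite convex function on R^n: where it is empty, the quadratic lower bound
   says nothing. *)
Definition strongly_convex_over {n} (f : 'cV[R]_n -> R) (X : set 'cV[R]_n)
    (theta : R) : Prop :=
  (forall x, X x -> subdifferential f x !=set0) /\
  forall x y s, X x -> X y -> subdifferential f x s ->
    theta / 2 * enorm (x - y) ^+ 2 <= f y - f x - dotv s (y - x).

Definition lambda_max {n} (M : 'M[R]_n) : R := sup [set a | eigenvalue M a].

Definition sigma_max {q n} (M : 'M[R]_(q, n)) : R :=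
  Num.sqrt (lambda_max (M^T *m M)).

Definition gradient {q} (F : 'cV[R]_q -> R) (v : 'cV[R]_q) : 'cV[R]_q :=
  \col_(i < q) derive1 (fun t : R => F (v + t *: delta_mx i 0) : R^o) 0.

End Euclidean.

(* Data of: minimize f x subject to A' x + b' <= 0, A x + b = 0, x \in X. *)
Record problem (R : realType) (n m p : nat) := Problem {
  obj : 'cV[R]_n -> R;
  Ain : 'M[R]_(m, n);
  bin : 'cV[R]_m;
  Aeq : 'M[R]_(p, n);
  beq : 'cV[R]_p;
  dom : set 'cV[R]_n
}.

Section Problem.
Context {R : realType} {n m p : nat} (P : problem R n m p).

Definition Atilde : 'M[R]_(m + p, n) := col_mx (Ain P) (Aeq P).
Definition btilde : 'cV[R]_(m + p) := col_mx (bin P) (beq P).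

Definition gin (x : 'cV[R]_n) : 'cV[R]_m := Ain P *m x + bin P.
Definition geq (x : 'cV[R]_n) : 'cV[R]_p := Aeq P *m x + beq P.

Definition slater_point (x : 'cV[R]_n) : Prop :=
  [/\ relint (dom P) x, forall i, gin x i 0 < 0 & geq x = 0].

Record standing_assumptions (theta : R) : Prop := {
  dom_closed : closed (dom P);
  dom_convex : convex_set (dom P : set (convex_lmodType 'cV[R]_n));
  theta_gt0 : 0 < theta;
  obj_strongly_convex : strongly_convex_over (obj P) (dom P) theta;
  slater : exists x, slater_point x;
  constrained : (m + p != 0)%N;
  Aeq_neq0 : (p != 0)%N -> Aeq P != 0;
  Atilde_neq0 : Atilde != 0
}.

Definition feasible : set 'cV[R]_n :=
  [set x | [/\ dom P x, forall i, gin x i 0 <= 0 & geq x = 0]].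

Definition primal_optimal : set 'cV[R]_n := is_argmin (obj P) feasible.

Definition primal_value : R := inf (obj P @` feasible).

Definition infeasibility (x : 'cV[R]_n) : R :=
  Num.sqrt (enorm (geq x) ^+ 2 + \sum_(i < m) Num.max 0 (gin x i 0) ^+ 2).

Definition lagrangian (x : 'cV[R]_n) (u : 'cV[R]_(m + p)) : R :=
  obj P x + dotv u (Atilde *m x + btilde).

Definition dual (u : 'cV[R]_(m + p)) : R :=
  inf [set lagrangian x u | x in dom P].

Definition dual_dom : set 'cV[R]_(m + p) :=
  [set u | forall i : 'I_m, 0 <= u (lshift p i) 0].

Definition dual_optimal : set 'cV[R]_(m + p) := is_argmax dual dual_dom.

Definition dual_value : R := sup (dual @` dual_dom).

Definition lin_neg_dual (u v : 'cV[R]_(m + p)) : R :=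
  - dual v - dotv (gradient dual v) (u - v).

(* Since 0.-1 = 0, the conventions u_{-1} = u_0 and beta_{-1} = beta_0 are
   built into the indices k.-1. *)
Definition extrapolation (beta : nat -> R) (u : nat -> 'cV[R]_(m + p))
    (k : nat) : 'cV[R]_(m + p) :=
  u k + (beta k * ((beta k.-1)^-1 - 1)) *: (u k - u k.-1).

Record fast_dual_gradient (theta : R) (beta : nat -> R)
    (U : nat -> set 'cV[R]_(m + p)) (u : nat -> 'cV[R]_(m + p)) : Prop := {
  beta_init : beta 0%N = 1;
  u_init : dual_dom (u 0%N);
  U_closed : forall k, closed (U k);
  U_convex : forall k, convex_set (U k : set (convex_lmodType 'cV[R]_(m + p)));
  U_meets : forall k, U k `&` dual_optimal !=set0;
  u_step : forall k,
    let v := extrapolation beta u k in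
    is_argmin
      (fun w => lin_neg_dual w v +
                sigma_max Atilde ^+ 2 / (2 * theta) * enorm (w - v) ^+ 2)
      (U k `&` dual_dom) (u k.+1);
  beta_le : forall k, beta k.+1 <= 2 / (k + 3)%:R
}.

(* The upper bound 2 / (k + 3) alone does not exclude extrapolation factors
   beta_k (1 / beta_{k-1} - 1) that are undefined or arbitrarily large.  This is
   the usual condition on the parameters of an accelerated gradient method;
   beta_k = 2 / (k + 2) satisfies it. *)
Definition admissible_beta (beta : nat -> R) : Prop :=
  forall k, 0 < beta k /\
    (1 - beta k.+1) / beta k.+1 ^+ 2 <= 1 / beta k ^+ 2.

(* It is not enough for the rates that every U_k meets the dual optimal set.
   For f x = x ^ 2 / 2 on R with the constraint x + 1 <= 0 written twice,
   beta_k = 2 / (k + 2), u_0 = ustar = (1, 0), U_0 = {(1, 0)}, U_1 = {(0, 1)}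
   and U_2 = R ^ 2, the iterate u_3 = (0, 5 / 4) is not dual optimal although
   the bound on its dual gap is 0.  The condition below holds whenever U_k
   contains u_k and ustar. *)
Definition localizes (beta : nat -> R) (U : nat -> set 'cV[R]_(m + p))
    (u : nat -> 'cV[R]_(m + p)) (ustar : 'cV[R]_(m + p)) : Prop :=
  forall k, U k ((1 - beta k) *: u k + beta k *: ustar).

End Problem.

(* Main.v *)
Require Import Defs.
From HB Require Import structures.
From mathcomp Require Import all_boot all_order all_algebra.
From mathcomp Require Import all_classical all_reals all_analysis.
From mathcomp Require Import ring lra.
Import Order.TTheory GRing.Theory Num.Theory.
Import numFieldNormedType.Exports.

(** Write G x for the stacked constraint values, xbar w for the minimizer of the
    Lagrangian over the domain at the multiplier w, and d for the dual function.

    Strong convexity makes the Lagrangian grow quadratically away from xbar w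
    (lagrangian_growth).  Evaluating it at a neighbouring multiplier shows that d
    is concave with supergradient G (xbar w) (dual_le_linearization), and, since
    x |-> G x is sigma_max-Lipschitz (enorm_mulmx), that d lies above its
    linearization minus sigma ^ 2 / (2 theta) times the squared distance
    (dual_ge_linearization).  So d is differentiable with gradient G (xbar w)
    (gradient_dual), and each step of the algorithm minimizes a quadratic model
    that majorizes - d.

    The rate of the dual gap is the standard potential argument for accelerated
    gradient methods (one_step, accelerated_rate): every step is compared with the
    point (1 - beta k) u k + beta k ustar, which lies in the set over which the
    step minimizes.

    The first order condition at ustar over the cone of dual variables says that
    xbar ustar is feasible with complementary slackness.  Hence the duality gap
    is zero and xbar ustar is the primal solution (xbar_feasible, strong_duality,
    primal_optimalE).  Quadratic growth then bounds the squared distance from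
    xbar (u k) to the primal solution by 2 / theta times the dual gap, whence the
    rate of order 1 / k.  The infeasibility and the two objective gaps are all
    controlled by the distance between G (xbar (u k)) and G (xbar ustar), which is
    at most sigma_max times the distance of the points (infeasibility_le,
    obj_gap_ge, obj_gap_le).

    With inequality constraints only, the threshold on k guarantees that u k has a
    dual value at least that of ubar, and a strictly feasible point bounds the
    norm of such multipliers (multiplier_bound). *)

Local Open Scope classical_set_scope.
Local Open Scope ring_scope.

(** * The Euclidean inner product *)

Lemma le_of_eq {R : realType} (a b : R) : a = b -> a <= b.
Proof. by move=> ->. Qed.

(** The limit t -> 0 used three times below: for the stationarity of a maximizer
    of a Rayleigh quotient, for the growth of a strongly convex function at its
    minimizer, and for the first order optimality condition of the dual. *)
Lemma le0_of_le_small_multiples {R : realType} (a b : R) :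
  (forall t, 0 < t -> t < 1 -> a <= t * b) -> a <= 0.
Proof.
move=> h; rewrite leNgt; apply/negP => a0.
have hab : a <= 2^-1 * b by apply: h; lra.
have b0 : 0 < b by lra.
have t0 : 0 < a / (2 * b) by rewrite divr_gt0// mulr_gt0.
have t1 : a / (2 * b) < 1 by rewrite ltr_pdivrMr ?mulr_gt0//; lra.
have := h _ t0 t1.
have -> : a / (2 * b) * b = a / 2 by field; rewrite gt_eqF.
by lra.
Qed.

Section InnerProduct.
Context {R : realType} {q : nat}.
Implicit Types (u v w : 'cV[R]_q) (a : R).

Lemma dotvC u v : dotv u v = dotv v u.
Proof. by apply: eq_bigr => i _; rewrite mulrC. Qed.

Lemma dotvDl u v w : dotv (u + v) w = dotv u w + dotv v w.
Proof. by rewrite -big_split; apply: eq_bigr => i _; rewrite mxE mulrDl. Qed.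

Lemma dotvZl a u v : dotv (a *: u) v = a * dotv u v.
Proof. by rewrite mulr_sumr; apply: eq_bigr => i _; rewrite mxE mulrA. Qed.

Lemma dotvNl u v : dotv (- u) v = - dotv u v.
Proof. by rewrite -scaleN1r dotvZl mulN1r. Qed.

Lemma dotvDr u v w : dotv u (v + w) = dotv u v + dotv u w.
Proof. by rewrite dotvC dotvDl !(dotvC u). Qed.

Lemma dotvZr a u v : dotv u (a *: v) = a * dotv u v.
Proof. by rewrite dotvC dotvZl dotvC. Qed.

Lemma dotvNr u v : dotv u (- v) = - dotv u v.
Proof. by rewrite dotvC dotvNl dotvC. Qed.

Definition dotvE := (dotvDl, dotvDr, dotvNl, dotvNr, dotvZl, dotvZr).

Lemma dotv_ge0 v : 0 <= dotv v v.
Proof. by apply: sumr_ge0 => i _; rewrite -expr2 sqr_ge0. Qed.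

Lemma dotv_eq0 v : dotv v v = 0 -> v = 0.
Proof.
move=> /eqP; rewrite psumr_eq0; last by move=> i _; rewrite -expr2 sqr_ge0.
move=> /allP v0; apply/colP => i; rewrite mxE; apply/eqP.
by have := v0 i (mem_index_enum i); rewrite mulf_eq0 orbb.
Qed.

Lemma dotv_gt0 v : v != 0 -> 0 < dotv v v.
Proof.
move=> v0; rewrite lt_neqAle dotv_ge0 andbT eq_sym.
by apply: contra v0 => /eqP/dotv_eq0/eqP.
Qed.

Lemma dotv_delta u (i : 'I_q) : dotv u (delta_mx i 0) = u i 0.
Proof.
rewrite /dotv (bigD1 i)//= mxE !eqxx mulr1 big1 ?addr0// => j ji.
by rewrite mxE (negbTE ji) mulr0.
Qed.

Lemma enorm_ge0 v : 0 <= enorm v.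
Proof. exact: sqrtr_ge0. Qed.

Lemma enorm_sqr v : enorm v ^+ 2 = dotv v v.
Proof. by rewrite sqr_sqrtr// sumr_ge0// => i _; rewrite sqr_ge0. Qed.

Lemma enorm0 : enorm (0 : 'cV[R]_q) = 0.
Proof.
by apply/eqP; rewrite -sqrf_eq0 enorm_sqr -(scale0r 0) dotvZl mul0r.
Qed.

Lemma cauchy_schwarz u v : dotv u v <= enorm u * enorm v.
Proof.
have [->|v0] := eqVneq v 0.
  by rewrite -(scale0r 0) dotvZr mul0r mulr_ge0// enorm_ge0.
have vv := dotv_gt0 _ v0.
apply: le_trans (ler_norm _) _.
rewrite -(@ler_pXn2r _ 2%N)// ?nnegrE ?normr_ge0 ?mulr_ge0 ?enorm_ge0//.
rewrite real_normK ?num_real// exprMn !enorm_sqr.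
have := dotv_ge0 (dotv v v *: u - dotv u v *: v).
rewrite !dotvE (dotvC v u) => h.
rewrite -subr_ge0 -(pmulr_rge0 _ vv); apply: le_trans h _.
by apply: le_of_eq; ring.
Qed.

Lemma enorm_sqrZ a v : enorm (a *: v) ^+ 2 = a ^+ 2 * enorm v ^+ 2.
Proof. by rewrite !enorm_sqr !dotvE mulrA. Qed.

Lemma enormB u v : enorm (u - v) = enorm (v - u).
Proof.
by congr Num.sqrt; apply: eq_bigr => i _; rewrite -[in LHS]opprB mxE sqrrN.
Qed.

(** The squared distance to a point is strongly convex, and the defect on a
    segment is exact and independent of that point. *)
Lemma enorm_sqr_segment t u v w :
  enorm ((1 - t) *: u + t *: v - w) ^+ 2 =
  (1 - t) * enorm (u - w) ^+ 2 + t * enorm (v - w) ^+ 2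
  - t * (1 - t) * enorm (u - v) ^+ 2.
Proof. by rewrite !enorm_sqr !dotvE (dotvC v u) (dotvC w u) (dotvC w v); ring. Qed.

End InnerProduct.

Lemma dotv_mulmx {R : realType} {q r} (M : 'M[R]_(q, r)) x y :
  dotv (M *m x) y = dotv x (M^T *m y).
Proof.
rewrite /dotv; under eq_bigr do rewrite mxE mulr_suml.
rewrite exchange_big; apply: eq_bigr => j _ /=.
by rewrite mxE mulr_sumr; apply: eq_bigr => i _; rewrite mxE; ring.
Qed.

(** * The largest singular value as an operator norm *)

Section SpectralNorm.
Context {R : realType}.

(** Stated on row vectors, for which bounded closed sets are known to be
    compact. *)
Lemma enorm_sqr_mulmx_continuous q r (M : 'M[R]_(q, r)) :
  continuous (fun v : 'rV[R]_r => enorm (M *m v^T) ^+ 2).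
Proof.
have sumC k (F : 'I_k -> 'rV[R]_r -> R) :
    (forall i, continuous (F i)) -> continuous (fun v => \sum_(i < k) F i v).
  by move=> cF; apply: continuous_big => [|i _]; [exact: add_continuous|exact: cF].
have -> : (fun v : 'rV[R]_r => enorm (M *m v^T) ^+ 2) =
    (fun v => \sum_(i < q) (\sum_(j < r) M i j * v 0 j) ^+ 2).
  apply/funext => w; rewrite enorm_sqr; apply: eq_bigr => i _.
  by rewrite -expr2; congr (_ ^+ 2); rewrite mxE; apply: eq_bigr => j _; rewrite mxE.
apply: (sumC) => i v.
apply: (@continuous_comp _ _ _ (fun w : 'rV[R]_r => \sum_(j < r) M i j * w 0 j)
  (fun x => x ^+ 2)); last exact: exprn_continuous.
apply: (sumC) => j {}v.
exact: (cvgM (cvg_cst (M i j)) (@coord_continuous R 1 r 0 j v)).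
Qed.

(** The maximum is attained on the compact unit sphere, and the bound extends to
    all vectors by homogeneity. *)
Lemma rayleigh_max q r (M : 'M[R]_(q, r.+1)) :
  exists2 x, enorm x ^+ 2 = 1 &
    forall y, enorm (M *m y) ^+ 2 <= enorm (M *m x) ^+ 2 * enorm y ^+ 2.
Proof.
pose A := [set v : 'rV[R]_r.+1 | enorm v^T ^+ 2 = 1].
have Acpt : compact A.
  apply: bounded_closed_compact.
    exists 1; split; first exact: real1.
    move=> K K1 v /= vA; apply: (le_trans _ (ltW K1)).
    rewrite [leLHS]/Num.norm /= mx_normrE; apply/bigmax_leP; split=> // -[i j] _ /=.
    rewrite -(@ler_pXn2r _ 2%N)// ?nnegrE ?normr_ge0// expr1n real_normK ?num_real//.
    rewrite -vA enorm_sqr /dotv (bigD1 j)//= !mxE ord1 expr2 lerDl.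
    by apply: sumr_ge0 => k _; rewrite -expr2 sqr_ge0.
  rewrite (_ : A = (fun v : 'rV[R]_r.+1 => enorm (1%:M *m v^T) ^+ 2) @^-1` [set 1]).
    apply: preimage_closed; last exact: closed_eq.
    by move=> v _; exact: enorm_sqr_mulmx_continuous.
  by apply/seteqP; split=> v /=; rewrite mul1mx.
have A0 : A !=set0.
  exists (delta_mx 0 0); rewrite /A/= enorm_sqr.
  by rewrite trmx_delta dotv_delta mxE !eqxx.
have [x /set_mem xA xmax] := compact_EVT_max A0 Acpt
  (continuous_subspaceT (enorm_sqr_mulmx_continuous _ _ M)).
exists x^T => // y; have [->|y0] := eqVneq y 0.
  by rewrite mulmx0 !enorm0 expr0n mulr0.
have ny := dotv_gt0 _ y0.
have := xmax ((enorm y)^-1 *: y)^T; rewrite trmxK.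
rewrite inE /A /= trmxK enorm_sqr !dotvE -enorm_sqr.
have e0 : enorm y != 0 by rewrite -sqrf_eq0 enorm_sqr gt_eqF.
have -> : (enorm y)^-1 * ((enorm y)^-1 * enorm y ^+ 2) = 1 by field.
move/(_ erefl); rewrite -scalemxAr enorm_sqr !dotvE -enorm_sqr => h.
rewrite -ler_pdivrMr; last by rewrite enorm_sqr.
by apply: le_trans h; apply: le_of_eq; field.
Qed.

(** A unit vector z maximizing the norm of M z is an eigenvector of M^T M, for the
    eigenvalue l equal to the squared maximum.  No eigenvalue exceeds l, since an
    eigenvalue is a Rayleigh quotient; hence l is the largest one, and the
    maximality of z is the claimed bound. *)
Lemma enorm_mulmx q r (M : 'M[R]_(q, r)) x :
  enorm (M *m x) <= sigma_max M * enorm x.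
Proof.
case: r => [|r] in M x *.
  rewrite (_ : enorm (M *m x) = 0) ?mulr_ge0 ?enorm_ge0 ?sqrtr_ge0//.
  by apply/eqP; rewrite -sqrf_eq0 enorm_sqr dotv_mulmx /dotv big_ord0.
have [z z1 zmax] := rayleigh_max _ _ M.
set l := enorm (M *m z) ^+ 2 in zmax.
have l0 : 0 <= l by rewrite sqr_ge0.
pose S := M^T *m M.
have qS y : dotv y (S *m y) = enorm (M *m y) ^+ 2.
  by rewrite enorm_sqr dotv_mulmx mulmxA.
have ST : S^T = S by rewrite /S trmx_mul trmxK.
have eigS a : eigenvalue S a -> exists2 v : 'cV_r.+1, S *m v = a *: v & v != 0.
  move=> /eigenvalueP[v vS v0]; exists v^T; last first.
    by apply: contra v0 => /eqP/(congr1 trmx); rewrite trmxK trmx0 => ->.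
  by rewrite -[LHS]trmxK trmx_mul trmxK ST vS linearZ.
have Sz : S *m z = l *: z.
  (* The form of l - S is nonnegative and vanishes at z, so its bilinear form
     vanishes against z; test it with the residual h of the eigenvalue
     equation. *)
  have [h hE] : exists h, h = l *: z - S *m z by eexists.
  suff : h = 0 by rewrite hE => /subr0_eq ->.
  apply: dotv_eq0; apply/eqP; rewrite eq_le dotv_ge0 andbT.
  pose b := l * enorm h ^+ 2 - enorm (M *m h) ^+ 2.
  suff : 2 * dotv h h <= 0 by lra.
  apply: (@le0_of_le_small_multiples _ _ b) => t t0 t1.
  have := zmax (z - t *: h); rewrite -qS !enorm_sqr.
  rewrite mulmxBr -scalemxAr !dotvE qS -/l -enorm_sqr z1.
  have hz : dotv z (S *m h) = dotv h (S *m z) by rewrite dotvC dotv_mulmx ST.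
  have hh : dotv h h = l * dotv z h - dotv h (S *m z).
    by rewrite {1}hE !dotvE (dotvC (S *m z)).
  rewrite hz (qS h) (dotvC h z) -enorm_sqr => hle.
  by rewrite -(@ler_pM2l _ t)// /b; rewrite -enorm_sqr in hh; rewrite hh in hle *; lra.
have z0 : z != 0.
  apply/eqP => zz; move: z1; rewrite zz enorm0 expr0n.
  by move/eqP; rewrite eq_sym oner_eq0.
have le : eigenvalue S l.
  apply/eigenvalueP; exists z^T; last first.
    by apply: contra z0 => /eqP/(congr1 trmx); rewrite trmxK trmx0 => ->.
  by rewrite -[LHS]trmxK trmx_mul trmxK ST Sz linearZ.
have ub : ubound [set a | eigenvalue S a] l.
  move=> a /= /eigS[v Sv v0].
  have vv := dotv_gt0 _ v0.
  by rewrite -(ler_pM2r vv) -dotvZr -Sv qS -enorm_sqr.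
have -> : sigma_max M = Num.sqrt l.
  congr Num.sqrt; apply/eqP; rewrite eq_le; apply/andP; split.
    by apply: ge_sup => //; exists l.
  by apply: ub_le_sup => //; exists l.
rewrite -(@ler_pXn2r _ 2%N)// ?nnegrE ?enorm_ge0 ?mulr_ge0 ?enorm_ge0 ?sqrtr_ge0//.
by rewrite exprMn (@sqr_sqrtr _ l).
Qed.

End SpectralNorm.

(** * Quadratic growth and gradients *)

Section Growth.
Context {R : realType} {q : nat}.
Implicit Types (S : set 'cV[R]_q) (x y z : 'cV[R]_q).

Lemma convex_set_segment S : convex_set (S : set (convex_lmodType 'cV[R]_q)) ->
  forall t x y, 0 <= t -> t <= 1 -> S x -> S y -> S ((1 - t) *: x + t *: y).
Proof.
move=> cS t x y t0 t1 Sx Sy.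
have := cS y x (Itv01 t0 t1); rewrite !inE addrC; exact.
Qed.

(** Comparing the minimizer x with the point at parameter t on the segment to y
    gives the bound with c * (1 - t) in place of c; then t -> 0.  Working with
    segments rather than with subgradients of F at x avoids any optimality
    condition relative to S. *)
Lemma argmin_quadratic_growth S (F : 'cV[R]_q -> R) (c : R) x :
  (forall t a b, 0 < t -> t < 1 -> S a -> S b ->
     S ((1 - t) *: a + t *: b) /\
     F ((1 - t) *: a + t *: b) <=
       (1 - t) * F a + t * F b - c * (t * (1 - t)) * enorm (a - b) ^+ 2) ->
  is_argmin F S x -> forall y, S y -> F x + c * enorm (y - x) ^+ 2 <= F y.
Proof.
move=> hF [Sx xmin] y Sy; rewrite -subr_le0.
apply: (@le0_of_le_small_multiples _ _ (c * enorm (y - x) ^+ 2)) => t t0 t1.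
have [Sz Fz] := hF _ _ _ t0 t1 Sx Sy.
have hle := le_trans (xmin _ Sz) Fz; rewrite enormB in hle.
by rewrite -(@ler_pM2l _ t)//; lra.
Qed.

(** A quadratic error bound at v forces every partial difference quotient to
    converge at a linear rate. *)
Lemma gradient_eq (F : 'cV[R]_q -> R) (K : R) (g v : 'cV[R]_q) :
  (forall w, `|F w - F v - dotv g (w - v)| <= K * enorm (w - v) ^+ 2) ->
  gradient F v = g.
Proof.
move=> hF; apply/colP => i; rewrite mxE /derive1.
apply/cvg_lim => //; apply/cvgrPdist_le => e e0.
(* |K| + 1 and not |K|, so that the step bound e / (|K| + 1) makes sense even
   when K = 0. *)
have K0 : 0 < `|K| + 1 by rewrite ltr_pwDr.
near=> h.
have h0 : h != 0 by near: h; exact: nbhs_dnbhs_neq.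
rewrite addr0 scale0r addr0.
have := hF (v + h *: delta_mx i 0).
rewrite (_ : v + _ - v = h *: delta_mx i 0); last by rewrite addrC addKr.
rewrite enorm_sqr !dotvE !dotv_delta !mxE !eqxx mulr1 => hle.
rewrite distrC -(@ler_pM2l _ `|h|) ?normr_gt0// -normrM.
have -> : h * (h^-1 *: (F (v + h *: delta_mx i 0) - F v) - g i 0) =
    F (v + h *: delta_mx i 0) - F v - h * g i 0.
  by rewrite mulrBr; congr (_ - _); rewrite [LHS]mulrA divff // mul1r.
apply: le_trans hle _.
have -> : K * (h * h) = K * (`|h| * `|h|).
  by rewrite -normrM ger0_norm// -expr2 sqr_ge0.
rewrite mulrCA ler_pM2l ?normr_gt0//.
apply: (@le_trans _ _ ((`|K| + 1) * `|h|)).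
  by rewrite ler_wpM2r// (le_trans (ler_norm K))// lerDl.
rewrite mulrC -ler_pdivlMr//.
by near: h; apply: dnbhs0_le; rewrite divr_gt0.
Unshelve. all: by end_near. Qed.

End Growth.

(** * The accelerated projected gradient method *)

Section Acceleration.
Context {R : realType} {q : nat}.
Context (F : 'cV[R]_q -> R) (g : 'cV[R]_q -> 'cV[R]_q) (c : R).
Context (Fabove : forall v w, F v + dotv (g v) (w - v) <= F w).
Context (Fbelow : forall v w,
  F w <= F v + dotv (g v) (w - v) + c * enorm (w - v) ^+ 2).

(** The model minimized by a step is strongly convex with modulus 2 c, hence
    grows by c times the squared distance to its minimizer x; and F lies below
    the model at x. *)
Lemma prox_step S v x w :
  (forall t a b, 0 <= t -> t <= 1 -> S a -> S b -> S ((1 - t) *: a + t *: b)) ->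
  is_argmin (fun w => F v + dotv (g v) (w - v) + c * enorm (w - v) ^+ 2) S x ->
  S w ->
  F x <= F v + dotv (g v) (w - v) + c * enorm (w - v) ^+ 2
         - c * enorm (w - x) ^+ 2.
Proof.
move=> cS xmin Sw; rewrite lerBrDr.
pose model w := F v + dotv (g v) (w - v) + c * enorm (w - v) ^+ 2.
apply: le_trans (_ : model x + c * enorm (w - x) ^+ 2 <= model w).
  by rewrite lerD2r; exact: Fbelow.
apply: argmin_quadratic_growth xmin w Sw => t a b t0 t1 Sa Sb.
split; first by apply: cS => //; exact: ltW.
by apply: le_of_eq; rewrite enorm_sqr_segment !dotvE; ring.
Qed.

Context (beta : nat -> R) (u : nat -> 'cV[R]_q) (xs : 'cV[R]_q)
  (S : nat -> set 'cV[R]_q).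

Let v k := u k + (beta k * ((beta k.-1)^-1 - 1)) *: (u k - u k.-1).

Context (c0 : 0 <= c).
Context (beta0 : beta 0%N = 1).
Context (beta_gt0 : forall k, 0 < beta k).
Context (beta_le : forall k, beta k.+1 <= 2 / (k + 3)%:R).
Context (beta_rec : forall k,
  (1 - beta k.+1) / beta k.+1 ^+ 2 <= 1 / beta k ^+ 2).
Context (Sconvex : forall k t a b, 0 <= t -> t <= 1 -> S k a -> S k b ->
  S k ((1 - t) *: a + t *: b)).
Context (u_step : forall k, is_argmin
  (fun w => F (v k) + dotv (g (v k)) (w - v k) + c * enorm (w - v k) ^+ 2)
  (S k) (u k.+1)).
Context (Starget : forall k, S k ((1 - beta k) *: u k + beta k *: xs)).

(** The auxiliary sequence of the estimate-sequence analysis: u k is the convex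
    combination of u k.-1 and z k with weight beta k.-1 on z k, and the
    extrapolated point v k is the one of u k and z k with weight beta k on z k.
    The predecessor makes z 0 = u 0. *)
Let z k := u k.-1 + (beta k.-1)^-1 *: (u k - u k.-1).

Lemma beta_bound k : beta k <= 2 / (k + 2)%:R.
Proof.
case: k => [|k]; last by rewrite addSn -addnS.
by rewrite beta0 add0n divff// pnatr_eq0.
Qed.

Lemma beta_le1 k : beta k <= 1.
Proof.
apply: le_trans (beta_bound k) _.
by rewrite ler_pdivrMr ?ltr0n ?addn2// mul1r ler_nat.
Qed.

(** The prox inequality is applied to the point w = (1 - beta k) u k + beta k xs.
    Then w - v k and w - u k.+1 are the multiples by beta k of xs - z k and
    xs - z k.+1, so the quadratic terms telescope in k, while convexity of F
    bounds the linear model at w. *)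
Lemma one_step k :
  F (u k.+1) - F xs <= (1 - beta k) * (F (u k) - F xs) +
    c * beta k ^+ 2 * (enorm (xs - z k) ^+ 2 - enorm (xs - z k.+1) ^+ 2).
Proof.
set w := (1 - beta k) *: u k + beta k *: xs.
have b0 : beta k != 0 by rewrite gt_eqF.
have step := prox_step _ _ _ _ (Sconvex k) (u_step k) (Starget k).
have wv : w - v k = beta k *: (xs - z k).
  by apply/colP => i; rewrite !mxE; ring.
have wu : w - u k.+1 = beta k *: (xs - z k.+1).
  by apply/colP => i; rewrite !mxE /=; field.
move: step; rewrite -/w wu wv !enorm_sqrZ -wv.
have : F (v k) + dotv (g (v k)) (w - v k) <=
    (1 - beta k) * F (u k) + beta k * F xs.
  have -> : F (v k) + dotv (g (v k)) (w - v k) =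
    (1 - beta k) * (F (v k) + dotv (g (v k)) (u k - v k)) +
    beta k * (F (v k) + dotv (g (v k)) (xs - v k)).
    by rewrite /w !dotvE; ring.
  apply: lerD.
    by rewrite ler_wpM2l ?subr_ge0 ?beta_le1.
  by rewrite ler_wpM2l// ltW.
by lra.
Qed.

Context (xs_min : forall k, F xs <= F (u k)).

(** Dividing the one-step inequality by beta k ^ 2 and using the recursion on beta
    shows that the potential
    (F (u k.+1) - F xs) / beta k ^ 2 + c * enorm (xs - z k.+1) ^ 2
    does not increase; its first value is at most c * enorm (u 0 - xs) ^ 2, and
    beta k is at most 2 / (k + 2). *)
Lemma accelerated_rate k :
  F (u k.+1) - F xs <= 4 * c * enorm (u 0%N - xs) ^+ 2 / (k%:R + 2) ^+ 2.
Proof.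
have key : F (u k.+1) - F xs + c * beta k ^+ 2 * enorm (xs - z k.+1) ^+ 2
     <= c * beta k ^+ 2 * enorm (u 0%N - xs) ^+ 2.
  elim: k => [|k IH].
    have z0 : z 0 = u 0 by rewrite /z subrr scaler0 addr0.
    have := one_step 0; rewrite beta0 z0 (enormB xs).
    by lra.
  have a0 : 0 <= F (u k.+1) - F xs by rewrite subr_ge0.
  have b0 : 0 < beta k ^+ 2 by rewrite exprn_gt0.
  have b1 : 0 < beta k.+1 ^+ 2 by rewrite exprn_gt0.
  have contr : (1 - beta k.+1) * (F (u k.+1) - F xs) <= beta k.+1 ^+ 2 *
      (c * (enorm (u 0%N - xs) ^+ 2 - enorm (xs - z k.+1) ^+ 2)).
    have le1 := ler_wpM2r a0 (beta_rec k).
    have le2 : 1 / beta k ^+ 2 * (F (u k.+1) - F xs) <=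
        c * (enorm (u 0%N - xs) ^+ 2 - enorm (xs - z k.+1) ^+ 2).
      by rewrite mul1r ler_pdivrMl//; lra.
    rewrite -ler_pdivrMl// mulrA [_^-1 * _]mulrC.
    exact: le_trans le1 le2.
  by have := one_step k.+1; lra.
apply: (@le_trans _ _ (c * beta k ^+ 2 * enorm (u 0%N - xs) ^+ 2)).
  by apply: le_trans key; rewrite lerDl mulr_ge0 ?sqr_ge0// mulr_ge0 ?sqr_ge0.
have bsq : beta k ^+ 2 <= (2 / (k + 2)%:R) ^+ 2.
  by rewrite ler_pXn2r ?nnegrE ?beta_bound ?divr_ge0// ltW.
have -> : 4 * c * enorm (u 0%N - xs) ^+ 2 / (k%:R + 2) ^+ 2 =
    c * (2 / (k + 2)%:R) ^+ 2 * enorm (u 0%N - xs) ^+ 2.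
  by rewrite natrD; field; rewrite -natrD pnatr_eq0 addn2.
by rewrite ler_wpM2r ?sqr_ge0// ler_wpM2l.
Qed.

End Acceleration.

(** * The dual function *)

(** Add the subgradient inequalities at the intermediate point z toward both
    ends, with weights 1 - t and t: the linear terms cancel. *)
Lemma strongly_convex_segment {R : realType} {n} (f : 'cV[R]_n -> R) X theta t x y :
  strongly_convex_over f X theta -> 0 <= t -> t <= 1 -> X x -> X y ->
  X ((1 - t) *: x + t *: y) ->
  f ((1 - t) *: x + t *: y) <=
    (1 - t) * f x + t * f y - theta / 2 * (t * (1 - t)) * enorm (x - y) ^+ 2.
Proof.
set z := _ + _; move=> [subne sc] t0 t1 Xx Xy Xz.
have [s sz] := subne _ Xz.
have fx := sc z x s Xz Xx sz.
have fy := sc z y s Xz Xy sz.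
have zx : z - x = t *: (y - x) by apply/colP => i; rewrite !mxE; ring.
have zy : z - y = (1 - t) *: (x - y) by apply/colP => i; rewrite !mxE; ring.
rewrite -[x - z]opprB zx enorm_sqrZ enormB !dotvE in fx.
rewrite -[y - z]opprB zy enorm_sqrZ !dotvE in fy.
have t1' : 0 <= 1 - t by rewrite subr_ge0.
have := ler_wpM2l t1' fx; have := ler_wpM2l t0 fy.
by lra.
Qed.

Section Dual.
Context {R : realType} {n m p : nat} (P : problem R n m p) (theta : R).
Context (xbar : 'cV[R]_(m + p) -> 'cV[R]_n).
Context (hP : standing_assumptions P theta).
Context (hxbar : forall w, is_argmin (fun x => lagrangian P x w) (dom P) (xbar w)).

Let sigma := sigma_max (Atilde P).
Let d := dual P.
Let G x := Atilde P *m x + btilde P.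
Let D : set 'cV[R]_(m + p) := dual_dom.

Lemma lagrangian_growth w x : dom P x ->
  lagrangian P (xbar w) w + theta / 2 * enorm (x - xbar w) ^+ 2 <= lagrangian P x w.
Proof.
move: x; apply: (argmin_quadratic_growth _ (fun x => lagrangian P x w));
  last exact: hxbar.
move=> t a b t0 t1 Xa Xb; have t0' := ltW t0; have t1' := ltW t1.
have Xz := convex_set_segment _ (dom_convex hP) _ _ _ t0' t1' Xa Xb.
split=> //; rewrite /lagrangian.
have := strongly_convex_segment _ _ _ _ _ _ (obj_strongly_convex hP) t0' t1' Xa Xb Xz.
by rewrite mulmxDr -!scalemxAr !dotvE; lra.
Qed.

Lemma dualE w : d w = lagrangian P (xbar w) w.
Proof.
have [Xx xmin] := hxbar w.
apply/eqP; rewrite eq_le; apply/andP; split.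
  apply: ge_inf; last by exists (xbar w).
  by exists (lagrangian P (xbar w) w) => _ [x Xy <-]; exact: xmin.
apply: lb_le_inf; first by exists (lagrangian P (xbar w) w), (xbar w).
by move=> _ [x Xy <-]; exact: xmin.
Qed.

Lemma dual_growth w x : dom P x ->
  d w + theta / 2 * enorm (x - xbar w) ^+ 2 <= lagrangian P x w.
Proof. by rewrite dualE; exact: lagrangian_growth. Qed.

Lemma lagrangian_shift x v w :
  lagrangian P x v = lagrangian P x w + dotv (G x) (v - w).
Proof. by rewrite /lagrangian -/(G x) (dotvC v) (dotvC w) !dotvE; ring. Qed.

(** Evaluate the Lagrangian at the multiplier v and the point xbar w, which
    overshoots its minimum over the domain by quadratic growth.  In particular d
    is concave with supergradient G (xbar w). *)
Lemma dual_le_linearization v w :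
  d v + theta / 2 * enorm (xbar w - xbar v) ^+ 2 <= d w + dotv (G (xbar w)) (v - w).
Proof.
by rewrite [d w]dualE -lagrangian_shift; apply: dual_growth; case: (hxbar w).
Qed.

Lemma constraint_lipschitz x y : enorm (G x - G y) <= sigma * enorm (x - y).
Proof.
rewrite (_ : G x - G y = Atilde P *m (x - y)) ?enorm_mulmx//.
by rewrite mulmxBr /G opprD addrACA subrr addr0.
Qed.

(** Exchange the roles of v and w in the previous bound; the variation of the
    supergradient is then absorbed by the growth term through
    sigma e r <= theta / 2 e ^ 2 + sigma ^ 2 / (2 theta) r ^ 2.  This is the
    smoothness of the dual with constant sigma ^ 2 / theta. *)
Lemma dual_ge_linearization v w :
  d w + dotv (G (xbar w)) (v - w)
      - sigma ^+ 2 / (2 * theta) * enorm (v - w) ^+ 2 <= d v.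
Proof.
have th0 := theta_gt0 hP.
have h := dual_le_linearization w v.
set e := enorm (xbar v - xbar w) in h.
have cs : dotv (G (xbar w) - G (xbar v)) (v - w) <= sigma * e * enorm (v - w).
  apply: le_trans (cauchy_schwarz _ _) _; rewrite ler_wpM2r ?enorm_ge0//.
  by apply: le_trans (constraint_lipschitz _ _) _; rewrite enormB.
have amgm : sigma * e * enorm (v - w) <=
    theta / 2 * e ^+ 2 + sigma ^+ 2 / (2 * theta) * enorm (v - w) ^+ 2.
  rewrite -subr_ge0.
  have -> : theta / 2 * e ^+ 2 + sigma ^+ 2 / (2 * theta) * enorm (v - w) ^+ 2 -
      sigma * e * enorm (v - w) =
      (theta * e - sigma * enorm (v - w)) ^+ 2 / (2 * theta).
    by field; rewrite gt_eqF.
  by rewrite divr_ge0 ?sqr_ge0// mulr_ge0// ltW.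
by move: h cs amgm; rewrite !dotvE; lra.
Qed.

Lemma gradient_dual w : gradient d w = G (xbar w).
Proof.
apply: (@gradient_eq _ _ _ (sigma ^+ 2 / (2 * theta))) => v.
have th0 := theta_gt0 hP.
have c0 : 0 <= sigma ^+ 2 / (2 * theta) by rewrite divr_ge0 ?sqr_ge0// mulr_ge0// ltW.
have lo := dual_ge_linearization v w.
have hi := dual_le_linearization v w.
have s0 : 0 <= theta / 2 * enorm (xbar w - xbar v) ^+ 2.
  by rewrite mulr_ge0 ?sqr_ge0// divr_ge0// ltW.
have := mulr_ge0 c0 (sqr_ge0 (enorm (v - w))).
by rewrite ler_norml => ?; apply/andP; split; lra.
Qed.

Lemma dual_dom_segment t v w :
  0 <= t -> t <= 1 -> D v -> D w -> D ((1 - t) *: v + t *: w).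
Proof.
by move=> t0 t1 Dv Dw i; rewrite !mxE addr_ge0 // mulr_ge0 // subr_ge0.
Qed.

(** * Optimality conditions and duality *)

Section AtOptimum.
Context (us : 'cV[R]_(m + p)).
Context (hus : dual_optimal P us).

Lemma dual_first_order w : D w -> dotv (G (xbar us)) (w - us) <= 0.
Proof.
move=> Dw; have [Dus usmax] := hus.
apply: (@le0_of_le_small_multiples _ _
  (sigma ^+ 2 / (2 * theta) * enorm (w - us) ^+ 2)) => t t0 t1.
have := usmax _ (dual_dom_segment _ _ _ (ltW t0) (ltW t1) Dus Dw).
move/(le_trans (dual_ge_linearization _ us)).
rewrite (_ : _ + _ - us = t *: (w - us)); last by apply/colP => i; rewrite !mxE; ring.
rewrite enorm_sqrZ dotvZr -/d => h.
by rewrite -(@ler_pM2l _ t)//; lra.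
Qed.

(** The dual domain is a cone, so that both 0 and 2 us are admissible in the first
    order condition. *)
Lemma complementary_slackness : dotv us (G (xbar us)) = 0.
Proof.
have [Dus _] := hus.
have D0 : D 0 by move=> i; rewrite mxE.
have D2 : D (2 *: us) by move=> i; rewrite mxE mulr_ge0//; exact: Dus.
have := dual_first_order _ D0; have := dual_first_order _ D2.
by rewrite [dotv us _]dotvC sub0r !dotvE; lra.
Qed.

Lemma dual_cone_polar w : D w -> dotv w (G (xbar us)) <= 0.
Proof.
move=> /dual_first_order; rewrite dotvDr dotvNr [dotv _ us]dotvC.
by rewrite complementary_slackness subr0 dotvC.
Qed.

Lemma constraint_col x : G x = col_mx (gin P x) (Defs.geq P x).
Proof. by rewrite /G /Atilde mul_col_mx add_col_mx. Qed.

(** The constraint values at xbar us lie in the polar of the dual domain; testing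
    with coordinate vectors, of both signs for the equality rows, gives
    feasibility. *)
Lemma xbar_feasible : feasible P (xbar us).
Proof.
split; first by case: (hxbar us).
- move=> i; have := dual_cone_polar (delta_mx (lshift p i) 0).
  rewrite dotvC dotv_delta constraint_col col_mxEu; apply => j.
  by rewrite mxE; case: eqP.
- apply/colP => j; rewrite [RHS]mxE; apply/eqP; rewrite eq_le.
  have Dpm (a : R) : D (a *: delta_mx (rshift m j) 0).
    by move=> i; rewrite !mxE eq_lrshift mulr0.
  have := dual_cone_polar _ (Dpm 1); have := dual_cone_polar _ (Dpm (-1)).
  rewrite !dotvZl dotvC dotv_delta constraint_col col_mxEd.
  by move=> h1 h2; apply/andP; split; lra.
Qed.

Lemma lagrangian_le_obj x w : feasible P x -> D w -> lagrangian P x w <= obj P x.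
Proof.
move=> [_ gx ex] Dw; rewrite /lagrangian -/(G x) constraint_col ex.
rewrite gerDl /dotv big_split_ord /= [X in _ + X]big1 ?addr0.
  apply: sumr_le0 => i _; rewrite col_mxEu mulr_ge0_le0//; exact: Dw.
by move=> j _; rewrite col_mxEd mxE mulr0.
Qed.

Lemma weak_duality x w : feasible P x -> D w ->
  d w + theta / 2 * enorm (x - xbar w) ^+ 2 <= obj P x.
Proof.
move=> fx Dw; apply: le_trans (lagrangian_le_obj _ _ fx Dw).
by apply: dual_growth; case: fx.
Qed.

(** The optimal dual value is thus the objective value of a feasible point, and
    weak duality makes that point primal optimal. *)
Lemma strong_duality : d us = obj P (xbar us).
Proof. by rewrite dualE /lagrangian -/(G _) complementary_slackness addr0. Qed.

Lemma primal_optimalE x : primal_optimal P x -> x = xbar us.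
Proof.
move=> [fx xmin]; have := weak_duality _ _ fx (proj1 hus).
have := xmin _ xbar_feasible; rewrite strong_duality => h1 h2.
have th0 := theta_gt0 hP.
have : theta / 2 * enorm (x - xbar us) ^+ 2 <= 0 by lra.
rewrite pmulr_rle0 ?divr_gt0// enorm_sqr => h.
by apply: subr0_eq; apply: dotv_eq0; apply/eqP; rewrite eq_le h dotv_ge0.
Qed.

(** * Errors controlled by the variation of the constraint values *)

Lemma constraint_col_sub w :
  G (xbar w) - G (xbar us) =
  col_mx (gin P (xbar w) - gin P (xbar us)) (Defs.geq P (xbar w)).
Proof.
have [_ _ e0] := xbar_feasible.
by rewrite !constraint_col e0 opp_col_mx add_col_mx subr0.
Qed.

(** The positive part of an inequality value is at most its distance to the
    nonpositive value taken at the optimum. *)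
Lemma infeasibility_le w :
  infeasibility P (xbar w) <= enorm (G (xbar w) - G (xbar us)).
Proof.
have [_ g0 _] := xbar_feasible.
rewrite constraint_col_sub /infeasibility ler_wsqrtr// big_split_ord /= [leRHS]addrC.
apply: lerD.
  apply: le_of_eq; rewrite enorm_sqr.
  by apply: eq_bigr => j _; rewrite col_mxEd expr2.
apply: ler_sum => i _; rewrite col_mxEu !mxE.
have gi := g0 i; rewrite !mxE in gi.
rewrite /Num.max; case: ifP => [h|_]; last by rewrite expr0n sqr_ge0.
by rewrite ler_pXn2r ?nnegrE//; lra.
Qed.

(** By complementary slackness the inner product of us with G (xbar w) is its inner
    product with the difference G (xbar w) - G (xbar us). *)
Lemma obj_gap_ge w :
  - (enorm us * enorm (G (xbar w) - G (xbar us))) <=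
  obj P (xbar w) - obj P (xbar us).
Proof.
have Xw : dom P (xbar w) by case: (hxbar w).
have th0 := theta_gt0 hP.
have s0 : 0 <= theta / 2 * enorm (xbar w - xbar us) ^+ 2.
  by rewrite mulr_ge0 ?sqr_ge0// divr_ge0// ltW.
have := dual_growth us _ Xw; rewrite strong_duality /lagrangian -/(G _).
have := cauchy_schwarz us (G (xbar w) - G (xbar us)).
by rewrite dotvDr dotvNr complementary_slackness; lra.
Qed.

(** Minimality of xbar w for the multiplier w, compared with xbar us, already
    produces the difference of constraint values. *)
Lemma obj_gap_le w :
  obj P (xbar w) - obj P (xbar us) <=
  enorm w * enorm (G (xbar w) - G (xbar us)).
Proof.
have th0 := theta_gt0 hP.
have s0 : 0 <= theta / 2 * enorm (xbar us - xbar w) ^+ 2.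
  by rewrite mulr_ge0 ?sqr_ge0// divr_ge0// ltW.
have Xs : dom P (xbar us) by case: (hxbar us).
have := dual_growth w _ Xs; rewrite dualE /lagrangian -!/(G _).
have := cauchy_schwarz w (G (xbar us) - G (xbar w)).
by rewrite (enormB (G _)) dotvDr dotvNr; lra.
Qed.

Lemma dual_valueE : dual_value P = d us.
Proof.
have [Dus usmax] := hus; apply/eqP; rewrite eq_le; apply/andP; split.
  apply: ge_sup; first by exists (d us), us.
  by move=> _ [w Dw <-]; exact: usmax.
apply: ub_le_sup; last by exists us.
by exists (d us) => _ [w Dw <-]; exact: usmax.
Qed.

End AtOptimum.
End Dual.

Lemma primal_valueE {R : realType} {n m p} (P : problem R n m p) x :
  primal_optimal P x -> primal_value P = obj P x.
Proof.
move=> [fx xmin]; apply/eqP; rewrite eq_le; apply/andP; split.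
  apply: ge_inf; last by exists x.
  by exists (obj P x) => _ [y fy <-]; exact: xmin.
apply: lb_le_inf; first by exists (obj P x), x.
by move=> _ [y fy <-]; exact: xmin.
Qed.

Lemma relint_sub {R : realType} {n} (X : set 'cV[R]_n) : relint X `<=` X.
Proof. by move=> x [Ax [e e0 h]]; apply: h => //; rewrite subrr enorm0. Qed.

(** At a point x where all inequality values are at most gmax < 0, a large
    multiplier makes the Lagrangian small, hence also the dual value; with
    nonnegative entries the Euclidean norm is at most the sum of the entries. *)
Lemma multiplier_bound {R : realType} {n m} (P : problem R n m 0) theta xbar x
    gmax w :
  standing_assumptions P theta ->
  (forall w, is_argmin (fun x => lagrangian P x w) (dom P) (xbar w)) ->
  dom P x -> (forall i, gin P x i 0 <= gmax) -> gmax <= 0 -> dual_dom w ->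
  enorm w * - gmax <= obj P x - dual P w.
Proof.
move=> hP hxbar Xx gx g0 Dw.
have s0 : 0 <= theta / 2 * enorm (x - xbar w) ^+ 2.
  by rewrite mulr_ge0 ?sqr_ge0// divr_ge0// ltW// (theta_gt0 hP).
have := dual_growth P theta xbar hP hxbar w x Xx.
rewrite /lagrangian constraint_col.
have w0 i : 0 <= w i 0.
  by case: (split_ordP i) => [j ->|[]//]; exact: Dw.
have wsum : enorm w <= \sum_i w i 0.
  have sw : 0 <= \sum_i w i 0 by apply: sumr_ge0.
  rewrite -(@ler_pXn2r _ 2%N)// ?nnegrE ?enorm_ge0// enorm_sqr expr2 mulr_sumr.
  apply: ler_sum => i _; rewrite ler_wpM2r// (bigD1 i)//= lerDl.
  by apply: sumr_ge0.
have wg : dotv w (col_mx (gin P x) (Defs.geq P x)) <= gmax * \sum_i w i 0.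
  rewrite mulr_sumr; apply: ler_sum => i _; rewrite mulrC ler_wpM2r//.
  by case: (split_ordP i) => [j ->|[]//]; rewrite col_mxEu.
have : enorm w * - gmax <= (\sum_i w i 0) * - gmax by rewrite ler_wpM2r ?oppr_ge0.
by lra.
Qed.

(** * Convergence rates *)

Section Rate.
Context {R : realType} {n m p : nat} (P : problem R n m p) (theta : R).
Context (xbar : 'cV[R]_(m + p) -> 'cV[R]_n) (beta : nat -> R)
  (U : nat -> set 'cV[R]_(m + p)) (u : nat -> 'cV[R]_(m + p))
  (us : 'cV[R]_(m + p)).
Context (hP : standing_assumptions P theta).
Context (hxbar : forall w, is_argmin (fun x => lagrangian P x w) (dom P) (xbar w)).
Context (hu : fast_dual_gradient P theta beta U u).
Context (hus : dual_optimal P us).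
Context (hbeta : admissible_beta beta).
Context (hU : localizes beta U u us).

Let sigma := sigma_max (Atilde P).

Lemma iterate_dual_dom k : dual_dom (u k).
Proof.
case: k => [|k]; first exact: u_init hu.
by have [[]] := u_step hu k.
Qed.

(** The accelerated method applied to the convex function - d with the feasible
    sets U k `&` dual_dom and the quadratic coefficient sigma ^ 2 / (2 theta). *)
Lemma dual_gap_rate k :
  dual P us - dual P (u k.+1) <=
  2 * sigma ^+ 2 * enorm (u 0%N - us) ^+ 2 / (theta * (k%:R + 2) ^+ 2).
Proof.
have th0 := theta_gt0 hP.
set c := sigma ^+ 2 / (2 * theta).
have c0 : 0 <= c by rewrite divr_ge0 ?sqr_ge0// mulr_ge0// ltW.
pose F w := - dual P w.
pose g w := - (Atilde P *m xbar w + btilde P).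
have Fabove v w : F v + dotv (g v) (w - v) <= F w.
  have := dual_le_linearization P theta xbar hP hxbar w v.
  have : 0 <= theta / 2 * enorm (xbar v - xbar w) ^+ 2.
    by rewrite mulr_ge0 ?sqr_ge0// divr_ge0// ltW.
  by rewrite /F /g dotvNl; lra.
have Fbelow v w : F w <= F v + dotv (g v) (w - v) + c * enorm (w - v) ^+ 2.
  have := dual_ge_linearization P theta xbar hP hxbar w v.
  by rewrite /F /g /c /sigma dotvNl; lra.
have Sconvex j t a b : 0 <= t -> t <= 1 -> (U j `&` dual_dom) a ->
    (U j `&` dual_dom) b -> (U j `&` dual_dom) ((1 - t) *: a + t *: b).
  move=> t0 t1 [Ua Da] [Ub Db]; split; last exact: dual_dom_segment.
  by apply: convex_set_segment => //; exact: (U_convex hu).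
have step j : is_argmin (fun w => F (extrapolation beta u j) +
    dotv (g (extrapolation beta u j)) (w - extrapolation beta u j) +
    c * enorm (w - extrapolation beta u j) ^+ 2) (U j `&` dual_dom) (u j.+1).
  have := u_step hu j; congr is_argmin; apply/funext => w.
  by rewrite /lin_neg_dual (gradient_dual P theta xbar hP hxbar) /g dotvNl.
have b0 j : 0 < beta j by case: (hbeta j).
have ble := beta_le1 beta (beta_init hu) (beta_le hu).
have target j : (U j `&` dual_dom) ((1 - beta j) *: u j + beta j *: us).
  split; first exact: hU.
  apply: dual_dom_segment => //; [exact: ltW|exact: iterate_dual_dom|by case: hus].
have usmin j : F us <= F (u j).
  by rewrite lerN2; apply: (proj2 hus); exact: iterate_dual_dom.
have -> : dual P us - dual P (u k.+1) = F (u k.+1) - F us.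
  by rewrite /F; ring.
apply: le_trans (accelerated_rate F g c Fabove Fbelow beta u us
  (fun j => U j `&` dual_dom) c0 (beta_init hu) b0 (beta_le hu)
  (fun j => proj2 (hbeta j)) Sconvex step target usmin k) _.
have k2 : k%:R + 2 != 0 :> R by rewrite -natrD pnatr_eq0 addn2.
by apply: le_of_eq; rewrite /c; field; rewrite k2 gt_eqF.
Qed.

End Rate.

Theorem proposition4p6 (R : realType) (n m p : nat) (P : problem R n m p)
    (theta : R) (xbar : 'cV[R]_(m + p) -> 'cV[R]_n) (xstar : 'cV[R]_n)
    (beta : nat -> R) (U : nat -> set 'cV[R]_(m + p))
    (u : nat -> 'cV[R]_(m + p)) (ustar : 'cV[R]_(m + p))
    (hP : standing_assumptions P theta)
    (hxbar : forall w, is_argmin (fun x => lagrangian P x w) (dom P) (xbar w))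
    (hxstar : primal_optimal P xstar)
    (hu : fast_dual_gradient P theta beta U u)
    (hustar : dual_optimal P ustar)
    (hbeta : admissible_beta beta)
    (hU : localizes beta U u ustar) :
  let sigma := sigma_max (Atilde P) in
  let f := obj P in
  let d := dual P in
  let fstar := primal_value P in
  let dstar := dual_value P in
  let dist0 := enorm (u 0%N - ustar) in
  (forall k : nat, (1 <= k)%N ->
    [/\ dstar - d (u k) <=
          2 * sigma ^+ 2 * dist0 ^+ 2 / (theta * (k%:R + 1) ^+ 2),
        enorm (xbar (u k) - xstar) <=
          2 * sigma * dist0 / (theta * (k%:R + 1)),
        - (2 * enorm ustar * sigma ^+ 2 * dist0 / (theta * (k%:R + 1))) <=
          f (xbar (u k)) - fstar,
        f (xbar (u k)) - fstar <=
          2 * enorm (u k) * sigma ^+ 2 * dist0 / (theta * (k%:R + 1)) &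
        infeasibility P (xbar (u k)) <=
          2 * sigma ^+ 2 * dist0 / (theta * (k%:R + 1))]) /\
  (p = 0%N ->
    forall (xtilde : 'cV[R]_n) (ubar : 'cV[R]_(m + p)),
      slater_point P xtilde -> dual_dom ubar -> ~ dual_optimal P ubar ->
      forall k : nat,
        sigma * dist0 * Num.sqrt (2 * theta^-1 / (dstar - d ubar)) < k%:R ->
        f (xbar (u k)) - fstar <=
          2 * sigma ^+ 2 * (d ubar - f xtilde) * dist0 /
          (theta * (k%:R + 1) * sup (range (fun i : 'I_m => gin P xtilde i 0)))).
Proof.
move=> sigma f d fstar dstar dist0.
have th0 := theta_gt0 hP.
have sg0 : 0 <= sigma by exact: sqrtr_ge0.
have r0 : 0 <= dist0 by exact: enorm_ge0.
have fstarE : fstar = f xstar by exact: primal_valueE.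
have xsE : xstar = xbar ustar.
  exact: (primal_optimalE P theta xbar hP hxbar ustar hustar).
have dstarE : dstar = d ustar by exact: dual_valueE.
have Du k : dual_dom (u k) by exact: (iterate_dual_dom P theta beta U u hu).
(* The common bound on the variation of the constraint values. *)
pose B k := 2 * sigma ^+ 2 * dist0 / (theta * (k%:R + 1)).
have K0 k : 0 < k%:R + 1 :> R by rewrite ltr_wpDl.
have gap k : (1 <= k)%N ->
    dstar - d (u k) <= 2 * sigma ^+ 2 * dist0 ^+ 2 / (theta * (k%:R + 1) ^+ 2).
  case: k => // k _; rewrite dstarE.
  have := dual_gap_rate P theta xbar beta U u ustar hP hxbar hu hustar hbeta hU k.
  by have -> : k.+1%:R + 1 = k%:R + 2 :> R by ring.
have dist k : (1 <= k)%N ->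
    enorm (xbar (u k) - xstar) <= 2 * sigma * dist0 / (theta * (k%:R + 1)).
  move=> k1.
  have k0 : k%:R + 1 != 0 :> R by rewrite gt_eqF.
  rewrite -(@ler_pXn2r _ 2%N)// ?nnegrE ?enorm_ge0 ?divr_ge0 ?mulr_ge0//; last 1 first.
    by rewrite ltW// mulr_gt0.
  have th2 : 0 < theta / 2 by rewrite divr_gt0.
  rewrite -(ler_pM2l th2) enormB.
  have -> : theta / 2 * (2 * sigma * dist0 / (theta * (k%:R + 1))) ^+ 2 =
      2 * sigma ^+ 2 * dist0 ^+ 2 / (theta * (k%:R + 1) ^+ 2).
    by field; rewrite k0 gt_eqF.
  apply: le_trans (gap _ k1).
  have := weak_duality P theta xbar hP hxbar xstar (u k) (proj1 hxstar) (Du k).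
  rewrite dstarE /d (strong_duality P theta xbar hP hxbar ustar hustar) -xsE.
  by lra.
have res k : (1 <= k)%N ->
    enorm (Atilde P *m xbar (u k) + btilde P -
           (Atilde P *m xbar ustar + btilde P)) <= B k.
  move=> k1; apply: le_trans (constraint_lipschitz P _ _) _.
  rewrite -xsE; have -> : B k = sigma * (2 * sigma * dist0 / (theta * (k%:R + 1))).
    by rewrite /B; ring.
  by rewrite ler_wpM2l// dist.
have upper k : (1 <= k)%N -> f (xbar (u k)) - fstar <= enorm (u k) * B k.
  move=> k1; rewrite fstarE xsE.
  apply: le_trans (obj_gap_le P theta xbar hP hxbar ustar (u k)) _.
  by rewrite ler_wpM2l ?enorm_ge0// res.
split=> [k k1|p0 xt ub slt Dub nub k hk].
  split; [exact: gap|exact: dist| | |].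
  - rewrite fstarE xsE.
    apply: le_trans (obj_gap_ge P theta xbar hP hxbar ustar hustar (u k)).
    rewrite lerN2.
    have -> : 2 * enorm ustar * sigma ^+ 2 * dist0 / (theta * (k%:R + 1)) =
        enorm ustar * B k by rewrite /B; ring.
    by rewrite ler_wpM2l ?enorm_ge0// res.
  - apply: le_trans (upper _ k1) _.
    by apply: le_of_eq; rewrite /B; ring.
  - apply: le_trans (res _ k1).
    exact: (infeasibility_le P theta xbar hP hxbar ustar hustar).
subst p.
have k1 : (1 <= k)%N.
  rewrite -(ltr0n R); apply: le_lt_trans hk.
  by rewrite mulr_ge0 ?sqrtr_ge0// mulr_ge0.
have k0 : k%:R + 1 != 0 :> R by rewrite gt_eqF.
have ubgap : 0 < dstar - d ub.
  rewrite dstarE subr_gt0 lt_neqAle (proj2 hustar)// andbT.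
  apply/eqP => e; apply: nub; split=> // w Dw.
  by rewrite -/d e; exact: (proj2 hustar).
have dub : d ub <= d (u k).
  have h : 2 * sigma ^+ 2 * dist0 ^+ 2 / (theta * (k%:R + 1) ^+ 2) <= dstar - d ub.
    have hk2 : 2 * sigma ^+ 2 * dist0 ^+ 2 / (theta * (dstar - d ub)) <=
        (k%:R + 1) ^+ 2.
      have -> : 2 * sigma ^+ 2 * dist0 ^+ 2 / (theta * (dstar - d ub)) =
          (sigma * dist0 * Num.sqrt (2 / theta / (dstar - d ub))) ^+ 2.
        rewrite exprMn (@sqr_sqrtr _ (_ / _)); last by rewrite divr_ge0 ?divr_ge0// ltW.
        by field; rewrite !gt_eqF.
      have hk0 : 0 <= sigma * dist0 * Num.sqrt (2 / theta / (dstar - d ub)).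
        by rewrite mulr_ge0 ?sqrtr_ge0// mulr_ge0.
      rewrite ler_pXn2r ?nnegrE ?(ltW (K0 _))//.
      by rewrite ltW// (lt_trans hk)// ltrDl.
    rewrite ler_pdivrMr ?mulr_gt0// in hk2.
    by rewrite ler_pdivrMr ?mulr_gt0 ?exprn_gt0//; lra.
  by have := gap _ k1; lra.
have [slt1 slt2 _] := slt.
have Xt := relint_sub _ _ slt1.
have m0 : (0 < m)%N by rewrite lt0n; have := constrained hP; rewrite addn0.
set gmax := sup _.
have rng0 : range (fun i : 'I_m => gin P xt i 0) !=set0.
  by exists (gin P xt (Ordinal m0) 0), (Ordinal m0).
have gle i : gin P xt i 0 <= gmax.
  apply: ub_le_sup; last by exists i.
  by exists 0 => _ [j _ <-]; exact: ltW.
have glt : gmax < 0.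
  have [i _ imax] := @arg_maxP _ R _ (Ordinal m0) predT (fun i => gin P xt i 0) isT.
  apply: le_lt_trans (slt2 i); apply: ge_sup => // _ [j _ <-]; exact: imax.
have mb := multiplier_bound P theta xbar xt gmax (u k) hP hxbar Xt gle (ltW glt) (Du k).
apply: le_trans (upper _ k1) _.
have -> : 2 * sigma ^+ 2 * (d ub - f xt) * dist0 / (theta * (k%:R + 1) * gmax) =
    (f xt - d ub) / (- gmax) * B k.
  by rewrite /B; field; rewrite k0 (gt_eqF th0) (lt_eqF glt).
have B0 : 0 <= B k by rewrite /B divr_ge0 ?mulr_ge0 ?sqr_ge0// ltW.
rewrite ler_wpM2r// ler_pdivlMr ?oppr_gt0//.
by apply: le_trans mb _; rewrite lerB.
Qed.
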